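(* Let $\sigma=\{\sigma_i \mid i\in I\}$ be a partition of the set of all primes and let $G$ be a finite group. If $G$ possesses a complete Hall $\sigma$-set $\mathcal{H}$ such that the index $|G:N_{G}(H)|$ is $\sigma$-primary for all $H\in\mathcal{H}$, then $G$ is generalized $\sigma$-soluble.
   Context: All groups are finite. $\sigma=\{\sigma_i\mid i\in I\}$ is a partition of the set of all primes. For a positive integer $n$, $\pi(n)$ is the set of primes dividing $n$ and $\sigma(n)=\{\sigma_i \mid \sigma_i\cap\pi(n)\neq\emptyset\}$; for a group $G$, $\sigma(G)=\sigma(|G|)$. A positive integer $n$ is $\sigma$-primary if $|\sigma(n)|\leq 1$, i.e. all primes dividing $n$ lie in one $\sigma_i$. A set $\mathcal{H}$ of subgroups of $G$ is a complete Hall $\sigma$-set of $G$ if every member $\neq 1$ of $\mathcal{H}$ is a Hall $\sigma_i$-subgroup of $G$ for some $\sigma_i\in\sigma$, and $\mathcal{H}$ contains exactly one Hall $\sigma_i$-subgroup of $G$ for every $\sigma_i\in\sigma(G)$. $G$ is $\sigma$-full if it possesses a complete Hall $\sigma$-set. $G$ is generalized $\sigma$-soluble if $G$ is $\sigma$-full and $|\sigma(H/K)|\leq 2$ for every chief factor $H/K$ of $G$. *)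

(* Defs.v *)
From mathcomp Require Import all_boot all_fingroup all_solvable.
From mathcomp Require Import boolp classical_sets functions cardinality.

Set Implicit Arguments.
Unset Strict Implicit.
Unset Printing Implicit Defensive.

Local Open Scope classical_set_scope.
Local Open Scope group_scope.

(* [classical_sets.partition] asks the blocks to be nonempty and disjoint for
   distinct indices, so [sigma] is automatically injective. *)
Definition prime_partition (I : Type) (sigma : I -> set nat) : Prop :=
  classical_sets.partition [set: I]%classic sigma [set p | prime p]%classic.

(* The set of blocks meeting pi(n); sigma(G) is [sigma_of sigma #|G|]. *)
Definition sigma_of (I : Type) (sigma : I -> set nat) (n : nat) :
    set (set nat) :=
  [set sigma i | i in [set i | sigma i `&` [set` \pi(n)] !=set0]]%classic.

Definition sigma_primary (I : Type) (sigma : I -> set nat) (n : nat) : Prop :=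
  (sigma_of sigma n #<= `I_1)%card.

Definition sigma_Hall (I : Type) (sigma : I -> set nat) (i : I)
    (gT : finGroupType) (G H : {group gT}) : Prop :=
  [pred p in sigma i].-Hall(G) H.

Definition complete_Hall_set (I : Type) (sigma : I -> set nat)
    (gT : finGroupType) (G : {group gT}) (calH : {set {group gT}}) : Prop :=
  (forall H : {group gT}, H \in calH -> H :!=: 1 ->
     exists i : I, sigma_Hall sigma i G H) /\
  (forall i : I, sigma_of sigma #|G| (sigma i) ->
     exists! H : {group gT}, H \in calH /\ sigma_Hall sigma i G H).

Definition sigma_full (I : Type) (sigma : I -> set nat)
    (gT : finGroupType) (G : {group gT}) : Prop :=
  exists calH : {set {group gT}}, complete_Hall_set sigma G calH.

(* [chief_factor G K H] is the chief factor H / K, smaller group first. *)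
Definition generalized_sigma_soluble (I : Type) (sigma : I -> set nat)
    (gT : finGroupType) (G : {group gT}) : Prop :=
  sigma_full sigma G /\
  forall H K : {group gT}, chief_factor G K H ->
    (sigma_of sigma #|H / K| #<= `I_2)%card.

(* Main.v *)
(** Write j(i) for an index such that |G : N_G(H_i)| is a sigma_j(i)-number; then
    G = N_G(H_i) H_j(i), so the core in G of <H_i, H_j(i)> contains H_i.  A
    coprime index argument shows that H_k normalises H_i as soon as k <> i, j(i)
    and j(k) <> j(i).  If H_i normalises H_j(i), that core is a nontrivial normal
    subgroup involving at most two blocks.  Otherwise j is a fixed point free
    involution on the indices of nontrivial H_i, so every H_k with k <> i, j(i)
    centralises the core: then either no further block is involved in the core,
    or its centre is nontrivial and contains a normal q-subgroup of G.  Hence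
    every nontrivial quotient of G has a nontrivial normal subgroup involving
    at most two blocks.

    For a chief factor H / K, take N normal in G maximal with H :&: N <= K, and
    M / N such a normal subgroup of G / N: then H = K (H :&: M), so that |H / K|
    divides |M / N|. *)

Require Import Defs.
From mathcomp Require Import all_boot all_fingroup all_solvable.
From mathcomp Require Import boolp classical_sets functions cardinality.
(* [classical_sets] hides lemmas such as [subsetP] and [subset_trans]. *)
Import boot.fintype boot.finset.

Set Implicit Arguments.
Unset Strict Implicit.
Unset Printing Implicit Defensive.

Local Open Scope group_scope.

(** For g = n k with n normalising H and k in K, the conjugate of H by g is its conjugate by k,
    hence inside A; so A contains the normal closure of H. *)
Lemma sub_gcore_norm_mulg (gT : finGroupType) (G H A K : {group gT}) :
  H \subset A -> K \subset A -> 'N_G(H) * K = G -> H \subset gcore A G.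
Proof.
move=> sHA sKA defG; apply: subset_trans (sub_class_support _ _) _.
apply: gcore_max; last exact: class_support_norm.
rewrite class_supportEr; apply/bigcupsP => g; rewrite -defG.
case/mulsgP => n k /setIP[_ /normP nHn] kK ->.
by rewrite conjsgM nHn -(conjGid (subsetP sKA k kK)) conjSg.
Qed.

(** |H : H :&: K| = |HK : K| divides both |H| and |G : K|. *)
Lemma normal_sub_coprime_index (gT : finGroupType) (G H K : {group gT}) :
  H <| G -> K \subset G -> coprime #|H| #|G : K| -> H \subset K.
Proof.
move=> /andP[sHG nHG] sKG /eqP coHK; rewrite -indexg_eq1 -dvdn1 -coHK.
rewrite dvdn_gcd dvdn_indexg -[#|H : K|]indexMg.
rewrite (normC (subset_trans sKG nHG)) -norm_joinEr ?(subset_trans sKG) //.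
by rewrite indexSg ?joing_subr // join_subG sHG.
Qed.

(** Take ['O_q('Z(M))]: it is characteristic in M, and it is a Sylow subgroup of the abelian group
    ['Z(M)], hence nontrivial. *)
Lemma center_prime_normal (gT : finGroupType) (G M : {group gT}) (q : nat) :
    M <| G -> q \in \pi('Z(M)) ->
  exists N : {group gT}, [/\ N <| G, N :!=: 1 & q.-group N].
Proof.
move=> nMG; rewrite mem_primes => /and3P[q_pr _ q_dv].
exists 'O_q('Z(M))%G; split; last exact: pcore_pgroup.
  by rewrite (char_normal_trans (pcore_char _ _)) ?(char_normal_trans (center_char _)).
have hallO := nilpotent_pcore_Hall q (abelian_nil (center_abelian M)).
by rewrite trivg_card1 (card_Hall hallO) p_part_eq1 mem_primes q_pr cardG_gt0 q_dv.
Qed.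

Section HallFamily.

Variables (I : Type) (s : I -> nat_pred).
Hypothesis s_disj : forall i k p, p \in s i -> p \in s k -> i = k.

Lemma block_pnat_coprime i k m n :
  i <> k -> (s i).-nat m -> (s k).-nat n -> coprime m n.
Proof.
move=> neq_ik; apply: sub_pnat_coprime => p pk; apply/negP => pi.
by case: neq_ik; apply: s_disj pi pk.
Qed.

Variables (gT : finGroupType) (G : {group gT}) (h : I -> {group gT}) (j : I -> I).
Hypothesis hallh : forall i, (s i).-Hall(G) (h i).
Hypothesis indexh : forall i, (s (j i)).-nat #|G : 'N_G(h i)|.

(** The normalisers of [h i] and [h k] have coprime indices, so their product is G and their
    intersection has index |G : N_G(h i)| in N_G(h k). That index is coprime to |h k|, and [h k] is
    normal in N_G(h k). *)
Lemma block_Hall_norm i k :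
  i <> k -> j i <> k -> j i <> j k -> h k \subset 'N(h i).
Proof.
move=> neq_ik neq_jik neq_jj; have /and3P[shG pih _] := hallh k.
have defG : 'N_G(h i) * 'N_G(h k) = G.
  rewrite (coprime_index_mulG (subsetIl _ _) (subsetIl _ _)) //.
  exact: block_pnat_coprime neq_jj (indexh i) (indexh k).
have idx : #|'N_G(h k) : 'N_G(h k) :&: 'N_G(h i)| = #|G : 'N_G(h i)|.
  by rewrite indexgI -[LHS]indexMg defG.
have: h k \subset 'N_G(h k) :&: 'N_G(h i).
  apply: (normal_sub_coprime_index (normalSG shG)); first exact: subsetIl.
  rewrite idx coprime_sym; exact: block_pnat_coprime neq_jik (indexh i) pih.
by rewrite !subsetI => /and3P[_ _ ->].
Qed.

Lemma block_norm_mulg i : 'N_G(h i) * h (j i) = G.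
Proof.
have /and3P[shG pih p'ih] := hallh (j i).
rewrite (coprime_index_mulG (subsetIl _ _) shG) //.
exact: pnat_coprime (indexh i) p'ih.
Qed.

Lemma block_index_id_normal i : j i = i -> h i <| G.
Proof.
move=> jii; have /and3P[shG _ p'ih] := hallh i.
rewrite /normal shG -indexg_eq1 -indexgI -dvdn1.
have := indexh i; rewrite jii => pi1.
have /eqP <- := pnat_coprime pi1 p'ih.
by rewrite dvdn_gcd dvdnn indexgS // subsetI shG normG.
Qed.


Lemma block_gcore_sub i : h i \subset gcore (h i <*> h (j i)) G.
Proof.
apply: (sub_gcore_norm_mulg (joing_subl _ _) (joing_subr _ _)).
exact: block_norm_mulg.
Qed.

Lemma block_gcore_normal i : gcore (h i <*> h (j i)) G <| G.
Proof.
have [[shG _] [sh'G _]] := (andP (hallh i), andP (hallh (j i))).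
by rewrite gcore_normal // join_subG shG.
Qed.

Hypothesis s_cover : forall p, prime p -> exists i, p \in s i.

Lemma two_block_normal :
    G :!=: 1 ->
  exists (N : {group gT}) (i k : I),
    [/\ N <| G, N :!=: 1 & [predU s i & s k].-group N].
Proof.
move=> ntG; apply: contrapT => noN.
have no2 (N : {group gT}) i k :
    N <| G -> [predU s i & s k].-group N -> N :=: 1.
  move=> nNG piN; apply/eqP; apply/negPn/negP => ntN.
  by apply: noN; exists N, i, k.
have no1 (N : {group gT}) i : N <| G -> (s i).-group N -> N :=: 1.
  move=> nNG piN; apply: (no2 N i i nNG).
  by apply: sub_pgroup piN => p; rewrite !inE => ->.
have pih i : (s i).-group (h i) by have /and3P[] := hallh i.
have joinN i : h i :!=: 1 -> ~~ (h i \subset 'N(h (j i))).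
  move=> nti; apply/negP => nij; case/eqP: nti; apply/trivgP.
  apply: subset_trans (block_gcore_sub i) _.
  rewrite (no2 [group of gcore (h i <*> h (j i)) G] i (j i)) ?block_gcore_normal //.
  have: [predU s i & s (j i)].-group (h i * h (j i)).
    rewrite pgroupM; apply/andP.
    by split; apply: sub_pgroup (pih _) => p; rewrite !inE => ->; rewrite ?orbT.
  by rewrite -norm_joinEl //; apply: pgroupS; exact: gcore_sub.
have jneq i : h i :!=: 1 -> i <> j i.
  by move=> nti /esym/block_index_id_normal/no1/(_ (pih i))/eqP; rewrite (negPf nti).
have jntriv i : h i :!=: 1 -> h (j i) :!=: 1.
  by move=> /joinN; apply: contraNneq => ->; rewrite norms1.
(* Otherwise [block_Hall_norm] lets [h i] normalise [h (j i)], against [joinN]. *)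
have jj i : h i :!=: 1 -> j (j i) = i.
  move=> nti; apply: contrapT => neq; have /negP[] := joinN i nti.
  by apply: block_Hall_norm => //; [exact/nesym/jneq | exact/nesym/jneq/jntriv].
(* The two subgroups normalise each other and have coprime orders, so their commutator lies in a
   trivial intersection. *)
have cent i k : h i :!=: 1 -> k <> i -> k <> j i -> h k \subset 'C(h i).
  move=> nti neq_ki neq_kji.
  have [k1 | ntk] := eqVneq (h k :> {set gT}) 1; first by rewrite k1 sub1G.
  have neq_jj : j i <> j k by move=> e; apply: neq_ki; rewrite -(jj k) -?e ?jj.
  have nik : h k \subset 'N(h i) by apply: block_Hall_norm => //; exact/nesym.
  have nki : h i \subset 'N(h k).
    apply: block_Hall_norm => // [e|]; last exact/nesym.
    by apply: neq_kji; rewrite -e jj.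
  rewrite (sameP commG1P trivgP).
  rewrite -(coprime_TIg (block_pnat_coprime neq_ki (pih k) (pih i))).
  by apply: commg_subI; rewrite subsetI ?subxx.
have [i [p [p_pr pG psi]]] : exists i p, [/\ prime p, p %| #|G| & p \in s i].
  have p_pr : prime (pdiv #|G|) by rewrite pdiv_prime // cardG_gt1.
  by have [i psi] := s_cover p_pr; exists i, (pdiv #|G|); rewrite pdiv_dvd.
have nti : h i :!=: 1.
  apply/negP => /eqP h1; have := card_Hall (hallh i).
  rewrite h1 cards1 => /esym/eqP; rewrite partn_eq1 ?cardG_gt0 // => /pnatP.
  by move/(_ (cardG_gt0 G) p p_pr pG); rewrite inE /= psi.
set M : {group gT} := [group of gcore (h i <*> h (j i)) G].
have nMG : M <| G by exact: block_gcore_normal.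
case/eqP: (nti); apply/trivgP; apply: subset_trans (block_gcore_sub i) _.
apply/trivgP; apply: (no2 M i (j i) nMG).
(* A prime q of |M| outside both blocks lies in some block k. As [h k] centralises M, the Hall
   subgroup [h k :&: M] of M is central, so q divides |Z(M)|. *)
apply/pgroupP => q q_pr qM; rewrite !inE; apply: contrapT => /negP.
rewrite negb_or => /andP[qi qji].
have [k qk] := s_cover q_pr.
have ki : k <> i by move=> e; rewrite -e qk in qi.
have kji : k <> j i by move=> e; rewrite -e qk in qji.
have cM : h k \subset 'C(M).
  rewrite centsC; apply: subset_trans (gcore_sub _ _) _.
  rewrite join_subG ![_ \subset 'C(h k)]centsC cent //= cent ?jj //.
  exact: jntriv.
have hallM : (s k).-Hall(M) (h k :&: M) := Hall_setI_normal nMG (hallh k).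
have sZ : h k :&: M \subset 'Z(M)
  by rewrite subsetI subsetIr (subset_trans (subsetIl _ _)).
have qZ : q \in \pi('Z(M)).
  rewrite (pi_of_dvd (cardSg sZ)) ?cardG_gt0 // (card_Hall hallM).
  by rewrite pi_of_part ?cardG_gt0 // !inE mem_primes q_pr cardG_gt0 qM.
have [N [nNG ntN qN]] := center_prime_normal nMG qZ.
case/eqP: ntN; apply: (no1 N k nNG).
by apply: sub_pgroup qN => r /eqP ->.
Qed.

End HallFamily.

Lemma chief_factor_two_block (I : Type) (s : I -> nat_pred)
    (gT : finGroupType) (G H K : {group gT}) :
    (forall i k p, p \in s i -> p \in s k -> i = k) ->
    (forall p, prime p -> exists i, p \in s i) ->
    (forall i, exists L : {group gT} * I,
       (s i).-Hall(G) L.1 /\ (s L.2).-nat #|G : 'N_G(L.1)|) ->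
    chief_factor G K H ->
  exists i k, [predU s i & s k].-nat #|H / K|.
Proof.
(* The components of [f] play the roles of [h] and [j]; both properties pass to images modulo N. *)
move=> s_disj s_cover /choice[f hallf] /andP[/maxgroupP[/andP[prKH nKG] maxK] nHG].
have [sKH neqKH] := andP prKH.
pose trace_le (N : {group gT}) := (N <| G) && (H :&: N \subset K).
have trace1 : trace_le 1%G by rewrite /trace_le normal1 setIg1 sub1G.
have [N /maxgroupP[/andP[nNG sHNK] maxN] _] := maxgroup_exists trace1.
have sNG := normal_sub nNG; have nNG' := normal_norm nNG.
have ntGN : G / N != 1.
  rewrite -subG1 quotient_sub1 //; apply: contra neqKH => sGN.
  apply: subset_trans sHNK; rewrite subsetI subxx.
  exact: subset_trans (normal_sub nHG) sGN.
have [M' [i [k [nM'G ntM' piM']]]] :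
  exists (N0 : {group coset_of N}) (i k : I),
    [/\ N0 <| G / N, N0 :!=: 1 & [predU s i & s k].-group N0].
  apply: (@two_block_normal I s s_disj _ (G / N)%G (fun i => (f i).1 / N)%G
    (fun i => (f i).2)) => // i.
    have [hallfi _] := hallf i.
    exact: quotient_pHall (subset_trans (pHall_sub hallfi) nNG') hallfi.
  have [hallfi] := hallf i; apply: pnat_dvd => /=.
  have nNGL : G :&: 'N_G((f i).1) \subset 'N(N) by rewrite subIset ?nNG'.
  by apply: dvdn_trans (index_quotient nNGL); rewrite indexgS // quotient_subnorm.
have [M defM' sNM nMG] := inv_quotientN nNG nM'G.
(* Otherwise maximality of N gives M = N, and M / N would be trivial. *)
have sHMK : ~~ (H :&: M \subset K).
  apply: contra ntM' => sHMK; have := maxN M.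
  rewrite /trace_le nMG sHMK => /(_ isT sNM) eqMN.
  by rewrite defM' eqMN trivg_quotient.
exists i, k.
have sHG := normal_sub nHG; have nKH := subset_trans sHG nKG.
have nHM : H :&: M <| G by rewrite normalI.
have nKHM : H :&: M \subset 'N(K) by apply: subset_trans (subsetIl _ _) nKH.
(* K (H :&: M) is normal in G and lies between K and H; it is not K, so it is H by maximality of
   K. *)
have defH : K * (H :&: M) = H.
  rewrite -norm_joinEr //; apply/eqP; apply: contraNT sHMK => neq.
  have <- : K <*> (H :&: M) = K.
    have := maxK (K <*> (H :&: M))%G; rewrite joing_subl => e.
    rewrite [LHS]e // properEneq neq join_subG sKH subsetIl /=.
    by rewrite normsY // normal_norm.
  exact: joing_subr.
rewrite -defH quotientMidl.
have nNHM : H :&: M \subset 'N(N).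
  by apply: subset_trans nNG'; apply: subset_trans sHG; apply: subsetIl.
apply: (@pnat_dvd _ #|(H :&: M) / N|); last first.
  by apply: pnat_dvd piM'; rewrite defM' cardSg // quotientS // subsetIr.
rewrite card_quotient // card_quotient // -[X in _ %| X]indexgI -[X in X %| _]indexgI.
apply: indexgS; rewrite subsetI subsetIl /=.
by apply: subset_trans sHNK; rewrite setSI // subsetIl.
Qed.

Lemma card_le_two_block (I : Type) (sigma : I -> set nat) i k (n : nat) :
    (forall l m p, sigma l p -> sigma m p -> l = m) ->
    [predU [pred p in sigma i] & [pred p in sigma k]].-nat n ->
  (sigma_of sigma n #<= `I_2)%card.
Proof.
move=> disj pin; pose f m := if m == 0%N then sigma i else sigma k.
apply: card_le_trans (card_image_le f _).
apply: subset_card_le => _ /= [l [p [lp pn]] <-].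
have := pnatPpi pin pn; rewrite !inE => /orP[] /set_mem ip.
  by exists 0%N => //; rewrite (disj l i p lp ip).
by exists 1%N => //; rewrite (disj l k p lp ip).
Qed.

Lemma sigma_primary_pnat (I : Type) (sigma : I -> set nat) (i0 : I) (n : nat) :
    (forall p, prime p -> exists i, sigma i p) ->
    (0 < n)%N -> sigma_primary sigma n ->
  exists i, [pred p in sigma i].-nat n.
Proof.
move=> cover n_gt0 prim.
have [n_le1 | n_gt1] := leqP n 1.
  by exists i0; rewrite (_ : n = 1%N) //; apply/eqP; rewrite eqn_leq n_le1.
have p_pr := pdiv_prime n_gt1; have [i ip] := cover _ p_pr.
exists i; apply/pnatP => // q q_pr qn; have [k kq] := cover q q_pr.
rewrite inE /=; apply/mem_set.
have in_n l r : sigma l r -> prime r -> r %| n -> sigma_of sigma n (sigma l).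
  move=> lr r_pr rn; exists l => //; exists r; split=> //=.
  by rewrite mem_primes r_pr n_gt0.
(* [g] injects the blocks met by n into {0}, so any two of them are equal. *)
have /pcard_leP[g] := prim.
suff -> : sigma i = sigma k by [].
have si := in_n _ _ ip p_pr (pdiv_dvd n); have sk := in_n _ _ kq q_pr qn.
apply: (@inj _ _ _ g); rewrite ?mem_set //.
move: (@funS _ _ _ _ g _ si) (@funS _ _ _ _ g _ sk).
by rewrite /= !ltnS !leqn0 => /eqP-> /eqP->.
Qed.

Theorem theoremE (I : Type) (sigma : I -> set nat)
    (sigma_partition : prime_partition sigma)
    (gT : finGroupType) (G : {group gT}) :
  (exists calH : {set {group gT}},
     complete_Hall_set sigma G calH /\
     forall H : {group gT}, H \in calH ->
       sigma_primary sigma #|G : 'N_G(H)|%g) ->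
  generalized_sigma_soluble sigma G.
Proof.
have [cov triv _] := sigma_partition.
have disj l m p : sigma l p -> sigma m p -> l = m.
  by move=> lp mp; apply: triv => //; exists p.
have cover p : prime p -> exists i, sigma i p.
  move=> p_pr; have : [set q | prime q]%classic p by [].
  by rewrite -cov => -[i _ ip]; exists i.
move=> [calH [[calH1 calH2] prim]]; split; first by exists calH.
move=> H K chiefHK.
have [||i|i [k]] :=
  @chief_factor_two_block I (fun i => [pred p in sigma i]) _ G H K _ _ _ chiefHK.
- by move=> i k p /set_mem ip /set_mem kp; exact: disj ip kp.
- by move=> p /cover[i ip]; exists i; exact: mem_set.
- have [Gi | nGi] := pselect (sigma_of sigma #|G| (sigma i)).
    have [L [[LH hallL] _]] := calH2 i Gi.
    have [j piL] := sigma_primary_pnat i cover (indexg_gt0 _ _) (prim L LH).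
    by exists (L, j).
  (* For a block prime to |G|, the trivial group is the Hall subgroup; its normaliser has index 1,
     so any block index fits. *)
  exists (1%G, i); split=> /=.
    rewrite /pHall sub1G pgroup1 indexg1; apply/pnatP => // p p_pr pG; rewrite !inE.
    apply/negP => /set_mem ip; apply: nGi; exists i => //; exists p; split => //=.
    by rewrite mem_primes p_pr cardG_gt0.
  by rewrite norm1 setIT indexgg.
exact: card_le_two_block.
Qed.
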